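(* Let the system, box constraint sets $\mathbb{X},\mathbb{U}$ and gain matrix $K$ be as in the context. For $\lambda\in(0,1]^n$ let $\Lambda=\operatorname{diag}(\lambda)$ and consider the feedback law $\hat\mu(x)=K\Lambda x$, $x\in\mathbb{X}$. Let $$L=\{\lambda\in(0,1]^n : K\Lambda\bar x\le\bar u \ \text{ and }\ BK\Lambda\bar x\le 0\}.$$ Then $L\neq\emptyset$, and for every $\lambda\in(0,1]^n$, the feedback law $\hat\mu$ is admissible if and only if $\lambda\in L$.
   Context: Notation: inequalities between vectors are element-wise, $\mathbf{1}$ is the all-ones vector, $e_i$ is the $i$-th canonical basis vector of $\mathbb{R}^n$. System. Consider a directed graph with vertices $\mathcal{V}=\{1,\dots,n\}$ and an additional goal vertex $g=n+1$. Vertex $i\in\mathcal{V}$ has $m_i$ outgoing edges, each leading to a successor vertex $j\in(\mathcal{V}\cup\{g\})\setminus\{i\}$; $m=\sum_i m_i$. The matrix $B=(B_1\ \cdots\ B_n)\in\mathbb{R}^{n\times m}$ has blocks $B_i\in\mathbb{R}^{n\times m_i}$ with one column per outgoing edge of $i$ (ordered by the label of the successor): the column for edge $(i,j)$ with $j\in\mathcal{V}$ has entry $-1$ in row $i$, entry $1$ in row $j$, and zeros elsewhere; the column for edge $(i,g)$ has entry $-1$ in row $i$ and zeros elsewhere. The dynamics are $x(t+1)=x(t)+Bu(t)$ with $x(t)\in\mathbb{R}^n_{\ge0}$, $u(t)\in\mathbb{R}^m_{\ge0}$. Vectors in $\mathbb{R}^m$ are partitioned as $u=(u_1,\dots,u_n)$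 with $u_i\in\mathbb{R}^{m_i}$. Constraints. For $x\in\mathbb{R}^n_{\ge0}$ let $U(x)=\{u\in\mathbb{R}^m_{\ge0} : \mathbf{1}^\top u_i\le x_i\ \text{for all } i\in\mathcal{V}\}$. For given bounds $\bar x\in\mathbb{R}^n_{>0}$, $\bar u\in\mathbb{R}^m_{>0}$ let $\mathbb{X}=\{x\in\mathbb{R}^n_{\ge0}: x\le\bar x\}$, $\mathbb{U}=\{u\in\mathbb{R}^m_{\ge0}: u\le\bar u\}$, $\mathbb{U}(x)=U(x)\cap\mathbb{U}$. A feedback law $\mu$ is called admissible if for every $x\in\mathbb{X}$ one has $\mu(x)\in\mathbb{U}(x)$ and $x+B\mu(x)\in\mathbb{X}$. Gain matrix $K$. Let $s\in\mathbb{R}^n_{>0}$ and $r=(r_1,\dots,r_n)\in\mathbb{R}^m_{\ge0}$ be the weights of the linear stage cost $\ell(x,u)=s^\top x+r^\top u$. Standing assumption: there exists $p\in\mathbb{R}^n_{>0}$ with $$s+\sum_{i=1}^n\min\{r_i+B_i^\top p,\,0\}\,e_i=0,$$ where $\min\{r_i+B_i^\top p,0\}$ denotes the smallest number among the entries of the vector $r_i+B_i^\top p\in\mathbb{R}^{m_i}$ and $0$; fix such a $p$. For each $i\in\mathcal{V}$ let $k$ be the first index of a minimal entry of $r_i+B_i^\top p$, and let $K_i\in\mathbb{R}^{m_i\times n}$ be the matrix whose $k$-th row is $e_i^\top$ and whose other rows are zero. Then $K=\begin{pmatrix}K_1^\top&\cdots&K_n^\top\end{pmatrix}^\top\in\mathbb{R}^{m\times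 n}$. *)

(* Defs.v *)
From HB Require Import structures.
From mathcomp Require Import all_boot all_order all_algebra.

Set Implicit Arguments.
Unset Strict Implicit.
Unset Printing Implicit Defensive.

Import Order.TTheory GRing.Theory Num.Theory.
Local Open Scope ring_scope.

(* Written with MathComp over an arbitrary ordered field [R].

   The graph has vertices 'I_n plus a goal, labelled n (the last element of
   'I_n.+1).  [succ i : {set 'I_n.+1}] is the set of successors of i; the edges
   leaving i are numbered by 'I_(outdeg succ i), in increasing order of the
   label of the successor, since [enum] lists ordinals increasingly. *)

Definition vtx (n : nat) (i : 'I_n) : 'I_n.+1 := widen_ord (leqnSn n) i.

Definition no_self_loop (n : nat) (succ : 'I_n -> {set 'I_n.+1}) : Prop :=
  forall i : 'I_n, vtx i \notin succ i.

Definition outdeg (n : nat) (succ : 'I_n -> {set 'I_n.+1}) (i : 'I_n) : nat :=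
  #|succ i|.

Definition edge_target (n : nat) (succ : 'I_n -> {set 'I_n.+1}) (i : 'I_n)
  (k : 'I_(outdeg succ i)) : 'I_n.+1 := enum_val k.

(* The input space R^m is 'cV[R]_(nedges succ); the block u_i of an input u is
   [submxcol u i : 'cV[R]_(outdeg succ i)]. *)
Definition nedges (n : nat) (succ : 'I_n -> {set 'I_n.+1}) : nat :=
  (\sum_(i < n) outdeg succ i)%N.

(* [vtx a] is never the goal, so an edge (i, g) contributes only the entry -1. *)
Definition Bblock (R : realFieldType) (n : nat)
  (succ : 'I_n -> {set 'I_n.+1}) (i : 'I_n) : 'M[R]_(n, outdeg succ i) :=
  \matrix_(a < n, k < outdeg succ i)
    (if a == i then -1
     else if vtx a == edge_target k then 1
     else 0).

Definition Bmat (R : realFieldType) (n : nat)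
  (succ : 'I_n -> {set 'I_n.+1}) : 'M[R]_(n, nedges succ) :=
  \mxrow_(i < n) Bblock R succ i.

Definition vle (R : realFieldType) (d : nat) (x y : 'cV[R]_d) : Prop :=
  forall i : 'I_d, x i 0 <= y i 0.

Definition vlt (R : realFieldType) (d : nat) (x y : 'cV[R]_d) : Prop :=
  forall i : 'I_d, x i 0 < y i 0.

Definition state_box (R : realFieldType) (n : nat) (xbar x : 'cV[R]_n) : Prop :=
  vle 0 x /\ vle x xbar.

Definition input_box (R : realFieldType) (n : nat)
  (succ : 'I_n -> {set 'I_n.+1}) (ubar u : 'cV[R]_(nedges succ)) : Prop :=
  vle 0 u /\ vle u ubar.

Definition flow_constraint (R : realFieldType) (n : nat)
  (succ : 'I_n -> {set 'I_n.+1}) (x : 'cV[R]_n)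
  (u : 'cV[R]_(nedges succ)) : Prop :=
  vle 0 u /\
  forall i : 'I_n, \sum_(k < outdeg succ i) submxcol u i k 0 <= x i 0.

Definition input_set (R : realFieldType) (n : nat)
  (succ : 'I_n -> {set 'I_n.+1}) (ubar : 'cV[R]_(nedges succ)) (x : 'cV[R]_n)
  (u : 'cV[R]_(nedges succ)) : Prop :=
  flow_constraint x u /\ input_box ubar u.

(* Feedback laws are total functions; only their values on the state box matter. *)
Definition admissible (R : realFieldType) (n : nat)
  (succ : 'I_n -> {set 'I_n.+1}) (xbar : 'cV[R]_n)
  (ubar : 'cV[R]_(nedges succ))
  (mu : 'cV[R]_n -> 'cV[R]_(nedges succ)) : Prop :=
  forall x : 'cV[R]_n, state_box xbar x ->
    input_set ubar x (mu x) /\ state_box xbar (x + Bmat R succ *m mu x).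

Definition reduced_cost (R : realFieldType) (n : nat)
  (succ : 'I_n -> {set 'I_n.+1}) (r : 'cV[R]_(nedges succ)) (p : 'cV[R]_n)
  (i : 'I_n) : 'cV[R]_(outdeg succ i) :=
  submxcol r i + (Bblock R succ i)^T *m p.

Definition min_with_zero (R : realFieldType) (d : nat) (v : 'cV[R]_d) : R :=
  \big[Num.min/0]_(k < d) v k 0.

Definition cost_equation (R : realFieldType) (n : nat)
  (succ : 'I_n -> {set 'I_n.+1}) (s : 'cV[R]_n) (r : 'cV[R]_(nedges succ))
  (p : 'cV[R]_n) : Prop :=
  s + \sum_(i < n) min_with_zero (reduced_cost r p i) *: delta_mx i 0 = 0.

Definition first_argmin (R : realFieldType) (d : nat) (v : 'cV[R]_d)
  (k : 'I_d) : bool :=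
  [forall l : 'I_d, v k 0 <= v l 0] &&
  [forall l : 'I_d, (l < k)%N ==> (v k 0 < v l 0)].

(* If i has no outgoing edge, [Kblock] has no rows; [cost_equation] with s > 0
   excludes this case. *)
Definition Kblock (R : realFieldType) (n : nat)
  (succ : 'I_n -> {set 'I_n.+1}) (r : 'cV[R]_(nedges succ)) (p : 'cV[R]_n)
  (i : 'I_n) : 'M[R]_(outdeg succ i, n) :=
  \matrix_(k < outdeg succ i)
    (if first_argmin (reduced_cost r p i) k then delta_mx 0 i else 0).

Definition Kmat (R : realFieldType) (n : nat)
  (succ : 'I_n -> {set 'I_n.+1}) (r : 'cV[R]_(nedges succ))
  (p : 'cV[R]_n) : 'M[R]_(nedges succ, n) :=
  \mxcol_(i < n) Kblock r p i.

Definition Lambda_mx (R : realFieldType) (n : nat) (lambda : 'cV[R]_n) :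
  'M[R]_n := diag_mx lambda^T.

Definition scaled_feedback (R : realFieldType) (n : nat)
  (succ : 'I_n -> {set 'I_n.+1}) (r : 'cV[R]_(nedges succ))
  (p lambda : 'cV[R]_n) (x : 'cV[R]_n) : 'cV[R]_(nedges succ) :=
  Kmat r p *m Lambda_mx lambda *m x.

Definition in_unit_box (R : realFieldType) (n : nat) (lambda : 'cV[R]_n) :
  Prop := vlt 0 lambda /\ vle lambda (const_mx 1).

Definition Lset (R : realFieldType) (n : nat)
  (succ : 'I_n -> {set 'I_n.+1}) (r : 'cV[R]_(nedges succ)) (p : 'cV[R]_n)
  (xbar : 'cV[R]_n) (ubar : 'cV[R]_(nedges succ)) (lambda : 'cV[R]_n) : Prop :=
  [/\ in_unit_box lambda,
      vle (Kmat r p *m Lambda_mx lambda *m xbar) ubar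
    & vle (Bmat R succ *m Kmat r p *m Lambda_mx lambda *m xbar) 0].

(* Main.v *)
Require Import Defs.
From HB Require Import structures.
From mathcomp Require Import all_boot all_order all_algebra.
Import Order.TTheory GRing.Theory Num.Theory.
Local Open Scope ring_scope.

(** The cost equation with [s > 0] forces, at every vertex [i], a negative
    reduced cost, so [K] sends the content of [i] along one well-defined edge
    ([cost_equation_greedy_edge]), and since [r >= 0] the potential [p] strictly
    decreases along this edge ([reduced_cost_lt0_descent]).  Hence the edges
    used by [K] form a forest directed towards the goal, and with [y = Lambda x]
    the closed loop removes [y_a] from every vertex [a] and adds the [y_i] of
    its children [i] in that forest ([mul_Bmat_Kmat]).

    [L] is nonempty: on a forest there is a positive vector [w] whose value at
    each vertex dominates the sum of its values at the children
    ([superharmonic_weights]).  For small [eps > 0] the choice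
    [lambda_i = eps w_i / xbar_i] gives [Lambda xbar = eps w], which satisfies
    all the bounds.

    Admissibility is equivalent to [lambda \in L]: evaluating the closed loop at
    the corner [xbar] of the box gives exactly the inequalities of [L].
    Conversely, since [lambda <= 1], both [K Lambda] and [I + B K Lambda] are
    entrywise nonnegative, so inputs and successor states are monotone in [x],
    and [xbar] is the worst case. *)

(** * Auxiliary facts on finite families and orders *)

Lemma common_lower_bound {R : realFieldType} {I : finType} (f : I -> R) :
  (forall i, 0 < f i) -> exists2 e : R, 0 < e & forall i, e <= f i.
Proof.
move=> f_gt0; exists (\big[Num.min/1]_i f i); last by move=> i; exact: bigmin_le.
by apply/bigmin_gtP; split.
Qed.

(** If every edge of [e] strictly decreases [p], then [e] is acyclic, and the
    weight [#|V| ^ rank], where the rank of [a] counts the vertices of higher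
    potential, grows at least by a factor [#|V|] along each edge: this outweighs
    a sum over at most [#|V|] predecessors. *)
Lemma superharmonic_weights {R : realFieldType} {V : finType} (p : V -> R)
    (e : rel V) : (forall i a, e i a -> p a < p i) ->
  exists2 w : V -> R,
    (forall i, 0 < w i) & forall a, \sum_(i | e i a) w i <= w a.
Proof.
move=> e_desc.
pose rk a := #|[pred j | p a < p j]|; pose w a : R := #|V|%:R ^+ rk a.
have V_gt0 (a : V) : (0 < #|V|)%N by apply/card_gt0P; exists a.
have w_gt0 a : 0 < w a by rewrite exprn_gt0 // ltr0n (V_gt0 a).
exists w => // a; have N_gt0 : 0 < #|V|%:R :> R by rewrite ltr0n (V_gt0 a).
have w_step i : e i a -> w i <= w a / #|V|%:R.
  move=> /e_desc p_ai; rewrite ler_pdivlMr // -exprSr.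
  apply: ler_weXn2l; first by rewrite ler1n (V_gt0 a).
  apply: proper_card; apply/properP; split.
    by apply/subsetP => j; rewrite !inE; exact: lt_trans.
  by exists i; rewrite !inE ?ltxx.
apply: le_trans (ler_sum _ w_step) _.
have q_ge0 : 0 <= w a / #|V|%:R by rewrite ltW // divr_gt0.
apply: (@le_trans _ _ (\sum_(i : V) w a / #|V|%:R)).
  by rewrite big_mkcond ler_sum // => i _; case: ifP.
by rewrite sumr_const -[X in X <= _]mulr_natr divfK // gt_eqF.
Qed.

Lemma first_argmin_exists {R : realFieldType} {d : nat} (v : 'cV[R]_d)
    (k0 : 'I_d) : exists k : 'I_d, first_argmin v k.
Proof.
pose minimal k := [forall l, v k 0 <= v l 0].
have min1 : minimal [arg min_(k < k0) v k 0]%O.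
  by apply/forallP => l; case: arg_minP => // k _; apply.
exists [arg min_(k < [arg min_(k < k0) v k 0]%O | minimal k) (k : nat)].
case: arg_minnP => // k k_min k_first; apply/andP; split=> //.
apply/forallP => l; apply/implyP => l_lt_k.
rewrite lt_neqAle (forallP k_min) andbT; apply/eqP => eq_kl.
have l_min : minimal l.
  by apply/forallP => l'; rewrite -eq_kl (forallP k_min).
by have := k_first _ l_min; rewrite leqNgt l_lt_k.
Qed.

Lemma first_argmin_unique {R : realFieldType} {d : nat} (v : 'cV[R]_d)
    (k l : 'I_d) : first_argmin v k -> first_argmin v l = (l == k).
Proof.
move=> k_am; apply/idP/eqP => [l_am | -> //]; apply/val_inj/eqP.
case/andP: k_am => /forallP k_min /forallP k_first.
case/andP: l_am => /forallP l_min /forallP l_first.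
case: ltngtP => // [lt_lk | lt_kl].
- by have:= implyP (k_first l) lt_lk; rewrite ltNge l_min.
- by have:= implyP (l_first k) lt_kl; rewrite ltNge k_min.
Qed.

Lemma first_argmin_lt0 {R : realFieldType} {d : nat} (v : 'cV[R]_d) (k : 'I_d) :
  first_argmin v k -> min_with_zero v < 0 -> v k 0 < 0.
Proof.
case/andP=> /forallP k_min _; rewrite !ltNge; apply: contra => vk_ge0.
by apply/bigmin_geP; split=> // l _; exact: le_trans vk_ge0 (k_min l).
Qed.

(** * The edges selected by the gain matrix *)

(** [kappa i] is the outgoing edge of [i] on which [K] puts all its weight. *)
Definition greedy_edges {R : realFieldType} {n : nat}
    {succ : 'I_n -> {set 'I_n.+1}} (r : 'cV[R]_(nedges succ)) (p : 'cV[R]_n)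
    (kappa : forall i, 'I_(outdeg succ i)) : Prop :=
  forall i, first_argmin (reduced_cost r p i) (kappa i).

(** In row [i] the cost equation says that the minimum is [- s_i < 0]; it is
    therefore attained by an edge and not by the additional entry [0]. *)
Lemma cost_equation_greedy_edge {R : realFieldType} {n : nat}
    {succ : 'I_n -> {set 'I_n.+1}} (s : 'cV[R]_n) (r : 'cV[R]_(nedges succ))
    (p : 'cV[R]_n) : vlt 0 s -> cost_equation s r p ->
  exists2 kappa : forall i, 'I_(outdeg succ i),
    greedy_edges r p kappa & forall i, reduced_cost r p i (kappa i) 0 < 0.
Proof.
move=> s_gt0 cost.
have min_lt0 i : min_with_zero (reduced_cost r p i) < 0.
  move/matrixP/(_ i 0): cost; rewrite !mxE summxE (bigD1 i) //= big1.
    rewrite !mxE !eqxx mulr1 addr0 => /eqP; rewrite addrC addr_eq0 => /eqP ->.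
    by rewrite oppr_lt0; have := s_gt0 i; rewrite mxE.
  by move=> j ne_ji; rewrite !mxE eq_sym (negbTE ne_ji) mulr0.
have edge i : exists k, first_argmin (reduced_cost r p i) k.
  have [deg0 | deg_gt0] := posnP (outdeg succ i).
    have := min_lt0 i; rewrite ltNge => /negP[]; apply/bigmin_geP; split=> // k.
    by have := ltn_ord k; rewrite {2}deg0.
  exact: first_argmin_exists (Ordinal deg_gt0).
have [kappa kappaP] := fin_all_exists edge.
by exists kappa => // i; exact: first_argmin_lt0 (kappaP i) (min_lt0 i).
Qed.

(** The reduced cost of an edge [(i, a)] is [r_ia - p_i + p_a], with
    [r_ia >= 0]. *)
Lemma reduced_cost_lt0_descent {R : realFieldType} {n : nat}
    {succ : 'I_n -> {set 'I_n.+1}} (r : 'cV[R]_(nedges succ)) (p : 'cV[R]_n)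
    (i a : 'I_n) (k : 'I_(outdeg succ i)) :
  vle 0 r -> vtx a = edge_target k -> i != a -> reduced_cost r p i k 0 < 0 ->
  p a 0 < p i 0.
Proof.
move=> r_ge0 tgt_a ne_ia.
have tension : ((Bblock R succ i)^T *m p) k 0 = p a 0 - p i 0.
  rewrite mxE (bigD1 i) //= (bigD1 a) 1?eq_sym //=.
  rewrite big1 => [|j /andP[ne_ji ne_ja]].
    rewrite !mxE eqxx (eq_sym a) (negbTE ne_ia) tgt_a eqxx.
    by rewrite addr0 mul1r mulN1r addrC.
  rewrite !mxE (negbTE ne_ji) -tgt_a; case: eqP => [/(congr1 val) /= eq_ja|_].
    by rewrite (val_inj eq_ja) eqxx in ne_ja.
  by rewrite mul0r.
rewrite mxE tension mxE => cost_lt0.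
rewrite -subr_lt0; apply: le_lt_trans cost_lt0; rewrite lerDr.
by have := r_ge0 (tagnat.Rank i k); rewrite mxE.
Qed.

(** * Entries of the closed-loop maps *)

Lemma vle_submxcol {R : realFieldType} {n : nat} {q : 'I_n -> nat}
    (u v : 'cV[R]_(\sum_i q i)) :
  (forall i k, submxcol u i k 0 <= submxcol v i k 0) -> vle u v.
Proof.
by move=> le_uv j; have := le_uv (tagnat.sig1 j) (tagnat.sig2 j);
  rewrite !mxE tagnat.sig2K.
Qed.

Lemma mul_Lambda_mx {R : realFieldType} {n : nat} (lambda x : 'cV[R]_n) i :
  (Lambda_mx lambda *m x) i 0 = lambda i 0 * x i 0.
Proof. by rewrite mul_diag_mx !mxE. Qed.

Lemma scaled_feedbackE {R : realFieldType} {n : nat}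
    {succ : 'I_n -> {set 'I_n.+1}} (r : 'cV[R]_(nedges succ))
    (p lambda x : 'cV[R]_n) :
  scaled_feedback r p lambda x = Kmat r p *m (Lambda_mx lambda *m x).
Proof. by rewrite mulmxA. Qed.

Section GreedyEdges.
Context {R : realFieldType} {n : nat} {succ : 'I_n -> {set 'I_n.+1}}.
Context {r : 'cV[R]_(nedges succ)} {p : 'cV[R]_n}.
Context {kappa : forall i, 'I_(outdeg succ i)}.
Hypothesis kappaP : greedy_edges r p kappa.

(** The restriction [i != a] mirrors the precedence of the entry [-1] on the
    diagonal of [B]; an edge to the goal flows into no vertex. *)
Definition flows_into (i a : 'I_n) : bool :=
  (i != a) && (vtx a == edge_target (kappa i)).

Lemma mul_Kblock (y : 'cV[R]_n) i k :
  (Kblock r p i *m y) k 0 = if k == kappa i then y i 0 else 0.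
Proof.
rewrite mxE (bigD1 i) //= big1 ?addr0 => [|j ne_ji]; rewrite mxE.
  rewrite (first_argmin_unique _ _ _ (kappaP i)).
  by case: eqP; rewrite mxE ?eqxx ?mul1r ?mul0r.
by case: ifP; rewrite mxE ?eqxx ?(negbTE ne_ji) /= mul0r.
Qed.

Lemma mul_Kmat (y : 'cV[R]_n) i k :
  submxcol (Kmat r p *m y) i k 0 = if k == kappa i then y i 0 else 0.
Proof. by rewrite -submxcol_mul mxcolK mul_Kblock. Qed.

Lemma mul_Bmat_Kmat (y : 'cV[R]_n) a :
  (Bmat R succ *m (Kmat r p *m y)) a 0
    = - y a 0 + \sum_(i | flows_into i a) y i 0.
Proof.
rewrite mulmxA mul_mxrow_mxcol mulmx_suml summxE.
have entry i : (Bblock R succ i *m Kblock r p i *m y) a 0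
    = Bblock R succ i a (kappa i) * y i 0.
  rewrite -mulmxA mxE (bigD1 (kappa i)) //= mul_Kblock eqxx big1 ?addr0 //.
  by move=> k ne_k; rewrite mul_Kblock (negbTE ne_k) mulr0.
under eq_bigr do rewrite entry.
rewrite (bigD1 a) //= mxE eqxx mulN1r; congr (_ + _).
rewrite big_mkcond [RHS]big_mkcond; apply: eq_bigr => i _.
rewrite /flows_into mxE (eq_sym a); case: eqP => //= _.
by case: eqP; rewrite ?mul1r ?mul0r.
Qed.

(** * Monotonicity, and the equivalence with the bounds at the corner *)

Lemma Kmat_monotone (y z : 'cV[R]_n) :
  vle y z -> vle (Kmat r p *m y) (Kmat r p *m z).
Proof.
move=> le_yz; apply: vle_submxcol => i k.
by rewrite !mul_Kmat; case: ifP.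
Qed.

(** The diagonal of [I + B K Lambda] is [1 - lambda], and its other entries are
    [0] or some [lambda_i]. *)
Lemma closed_loop_monotone {lambda : 'cV[R]_n} (x z : 'cV[R]_n) :
  in_unit_box lambda -> vle x z ->
  vle (x + Bmat R succ *m scaled_feedback r p lambda x)
      (z + Bmat R succ *m scaled_feedback r p lambda z).
Proof.
case=> lambda_gt0 lambda_le1 le_xz a.
rewrite !scaled_feedbackE mxE [X in _ <= X]mxE !mul_Bmat_Kmat !addrA.
have sub_le (y : 'cV_n) :
    y a 0 - (Lambda_mx lambda *m y) a 0 = (1 - lambda a 0) * y a 0.
  by rewrite mul_Lambda_mx mulrBl mul1r.
rewrite !sub_le; apply: lerD.
  by rewrite ler_wpM2l // subr_ge0; have := lambda_le1 a; rewrite mxE.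
apply: ler_sum => i _; rewrite !mul_Lambda_mx ler_wpM2l //.
by have := lambda_gt0 i; rewrite mxE => /ltW.
Qed.

Lemma scaled_feedback_monotone {lambda : 'cV[R]_n} (x z : 'cV[R]_n) :
  in_unit_box lambda -> vle x z ->
  vle (scaled_feedback r p lambda x) (scaled_feedback r p lambda z).
Proof.
case=> lambda_gt0 _ le_xz; rewrite !scaled_feedbackE.
apply: Kmat_monotone => i; rewrite !mul_Lambda_mx ler_wpM2l //.
by have := lambda_gt0 i; rewrite mxE => /ltW.
Qed.

(** The whole outflow of [i] is [lambda_i x_i] on the edge [kappa i], so the
    flow constraint is where [lambda <= 1] enters for the inputs. *)
Lemma scaled_feedback_flow {lambda x : 'cV[R]_n} :
  in_unit_box lambda -> vle 0 x ->
  flow_constraint x (scaled_feedback r p lambda x).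
Proof.
move=> unit_lambda x_ge0; split.
  have := scaled_feedback_monotone _ _ unit_lambda x_ge0.
  by rewrite {1}/scaled_feedback mulmx0.
move=> i; rewrite scaled_feedbackE (bigD1 (kappa i)) //= big1 => [|k ne_k].
  rewrite mul_Kmat eqxx addr0 mul_Lambda_mx; case: unit_lambda => _ /(_ i).
  by have := x_ge0 i; rewrite !mxE => x_i /(ler_wpM2r x_i); rewrite mul1r.
by rewrite mul_Kmat (negbTE ne_k).
Qed.

(** [L] consists of the constraints that the closed loop must satisfy at the
    corner [xbar] of the state box. *)
Lemma Lset_bounds (xbar lambda : 'cV[R]_n) (ubar : 'cV[R]_(nedges succ)) :
  Lset r p xbar ubar lambda <->
  [/\ in_unit_box lambda, vle (scaled_feedback r p lambda xbar) ubar
    & vle (xbar + Bmat R succ *m scaled_feedback r p lambda xbar) xbar].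
Proof.
rewrite /Lset /scaled_feedback !mulmxA.
set z := (Bmat R succ *m _ *m _ *m _).
have drift : vle z 0 <-> vle (xbar + z) xbar.
  by split=> z_le i; have := z_le i;
    rewrite [(xbar + z) i 0]mxE gerDl [fun_of_matrix 0 _ _]mxE.
by split=> -[unit_lambda u_le /drift z_le].
Qed.

(** The lower bounds follow by comparison with the fixed point [0] of the closed
    loop, and the upper bounds by comparison with the corner [xbar]. *)
Lemma admissible_iff_Lset (xbar lambda : 'cV[R]_n)
    (ubar : 'cV[R]_(nedges succ)) :
  vle 0 xbar -> in_unit_box lambda ->
  admissible xbar ubar (scaled_feedback r p lambda)
    <-> Lset r p xbar ubar lambda.
Proof.
move=> xbar_ge0 unit_lambda; split=> [adm | /Lset_bounds[_ u_le x_le]].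
  apply/Lset_bounds.
  have corner : state_box xbar xbar by split=> // i; exact: lexx.
  by have [[_ [_ u_le]] [_ x_le]] := adm _ corner.
move=> x [x_ge0 x_le_xbar].
have flow := scaled_feedback_flow unit_lambda x_ge0.
split; split=> //.
- split; first by case: flow.
  move=> j; apply: le_trans (u_le j).
  exact: scaled_feedback_monotone unit_lambda x_le_xbar j.
- have := closed_loop_monotone _ _ unit_lambda x_ge0.
  by rewrite {1}/scaled_feedback !mulmx0 addr0.
- move=> i; apply: le_trans (x_le i).
  exact: closed_loop_monotone unit_lambda x_le_xbar i.
Qed.

(** * Existence of an admissible scaling *)

(** Prescribing the flow [e * w] out of the vertices at [xbar] makes the drift
    condition homogeneous in [e]; the remaining bounds only ask [e] to be small. *)
Lemma Lset_nonempty (xbar : 'cV[R]_n) (ubar : 'cV[R]_(nedges succ)) :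
  vlt 0 xbar -> vlt 0 ubar ->
  (forall i a, flows_into i a -> p a 0 < p i 0) ->
  exists lambda, Lset r p xbar ubar lambda.
Proof.
move=> xbar_gt0 ubar_gt0 desc.
have xb_gt0 i : 0 < xbar i 0 by have := xbar_gt0 i; rewrite mxE.
have [w w_gt0 w_dom] := superharmonic_weights (fun i => p i 0) _ desc.
have [e1 e1_gt0 e1_le] : exists2 e, 0 < e & forall i, e <= xbar i 0 / w i.
  by apply: common_lower_bound => i; rewrite divr_gt0.
have [e2 e2_gt0 e2_le] :
    exists2 e, 0 < e & forall j, e <= ubar j 0 / w (tagnat.sig1 j).
  apply: common_lower_bound => j; rewrite divr_gt0 //.
  by have := ubar_gt0 j; rewrite mxE.
pose e := Num.min e1 e2.
have e_gt0 : 0 < e by rewrite lt_min e1_gt0.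
pose lambda : 'cV[R]_n := \col_i (e * w i / xbar i 0).
have loaded i : (Lambda_mx lambda *m xbar) i 0 = e * w i.
  by rewrite mul_Lambda_mx mxE divfK // gt_eqF.
exists lambda; split.
- split=> i; rewrite !mxE; first by rewrite divr_gt0 ?mulr_gt0.
  rewrite ler_pdivrMr // mul1r -ler_pdivlMr //.
  by apply: le_trans (e1_le i); rewrite ge_min lexx.
- rewrite -mulmxA => j; rewrite -(tagnat.sig2K j).
  have := mul_Kmat (Lambda_mx lambda *m xbar) (tagnat.sig1 j) (tagnat.sig2 j).
  rewrite [submxcol _ _ _ _]mxE => ->; rewrite loaded tagnat.sig2K.
  case: ifP => _; last by have /ltW := ubar_gt0 j; rewrite mxE.
  rewrite -ler_pdivlMr //; apply: le_trans (e2_le j).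
  by rewrite ge_min lexx orbT.
- move=> a; rewrite -!mulmxA mul_Bmat_Kmat loaded mxE addrC subr_le0.
  under eq_bigr do rewrite loaded.
  by rewrite -mulr_sumr ler_pM2l.
Qed.

End GreedyEdges.

Theorem proposition1 (R : realFieldType) (n : nat)
  (succ : 'I_n -> {set 'I_n.+1}) (Hloop : no_self_loop succ)
  (xbar : 'cV[R]_n) (ubar : 'cV[R]_(nedges succ))
  (Hxbar : vlt 0 xbar) (Hubar : vlt 0 ubar)
  (s : 'cV[R]_n) (r : 'cV[R]_(nedges succ))
  (Hs : vlt 0 s) (Hr : vle 0 r)
  (p : 'cV[R]_n) (Hp : vlt 0 p) (Hcost : cost_equation s r p) :
  (exists lambda : 'cV[R]_n, Lset r p xbar ubar lambda) /\
  (forall lambda : 'cV[R]_n, in_unit_box lambda ->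
     (admissible xbar ubar (scaled_feedback r p lambda) <->
      Lset r p xbar ubar lambda)).
Proof.
have [kappa kappaP cost_lt0] := cost_equation_greedy_edge _ _ _ Hs Hcost.
split=> [|lambda].
  apply: (Lset_nonempty kappaP) => // i a /andP[ne_ia /eqP tgt_a].
  exact: reduced_cost_lt0_descent Hr tgt_a ne_ia (cost_lt0 i).
by apply: (admissible_iff_Lset kappaP) => i; exact/ltW/Hxbar.
Qed.
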